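(* Let $p\le n$ be positive integers. The set $\mathrm{Sp}(2p,2n)=\{X\in\mathbb{R}^{2n\times 2p}: X^\top J_{2n}X=J_{2p}\}$ is a closed embedded submanifold of the Euclidean space $\mathbb{R}^{2n\times 2p}$. Moreover, it has dimension $4np-p(2p-1)$.
   Context: For a positive integer $m$, $I_m$ is the $m\times m$ identity matrix and $J_{2m}=\begin{bmatrix}0&I_m\\-I_m&0\end{bmatrix}\in\mathbb{R}^{2m\times 2m}$. The set $\mathrm{Sp}(2p,2n)$ is called the symplectic Stiefel manifold. *)

(* Defs.v *)
From HB Require Import structures.
From mathcomp Require Import all_boot all_order all_algebra.
From mathcomp Require Import all_classical all_reals all_analysis.
Import numFieldNormedType.Exports.

Set Implicit Arguments.
Unset Strict Implicit.
Unset Printing Implicit Defensive.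

Import Order.TTheory GRing.Theory Num.Theory.
Local Open Scope classical_set_scope.
Local Open Scope ring_scope.

(* Only meaningful for an open D, on which differentiability and 'D_v f depend
   on the restriction of f to D alone. For V of finite dimension this is the
   usual notion: f is C^(k+1) iff it is differentiable and all its directional
   derivatives are C^k. *)
Fixpoint Ck_on (R : realType) (V W : normedModType R) (k : nat) (D : set V)
    (f : V -> W) : Prop :=
  match k with
  | 0%N => forall x, D x -> {for x, continuous f}
  | k'.+1 => (forall x, D x -> differentiable f x) /\
             (forall v : V, Ck_on k' D ('D_v f))
  end.

Definition smooth_on (R : realType) (V W : normedModType R) (D : set V)
    (f : V -> W) : Prop := forall k : nat, Ck_on k D f.

Section EmbeddedSubmanifold.
Variables (R : realType) (E : normedModType R) (d : nat).

(* The two maps are total functions; their values are relevant only on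
   chart_dom and on its image under chart_map, respectively. *)
Record chart := Chart {
  chart_dom : set E;
  chart_map : E -> 'rV[R]_d;
  chart_inv : 'rV[R]_d -> E
}.

Definition chart_img (c : chart) : set 'rV[R]_d := chart_map c @` chart_dom c.

(* c is a homeomorphism from an open subset of S, for the subspace topology,
   onto an open subset of R^d. *)
Definition is_chart (S : set E) (c : chart) : Prop :=
  [/\ exists2 O : set E, open O & chart_dom c = S `&` O,
      open (chart_img c),
      forall x, chart_dom c x -> chart_inv c (chart_map c x) = x,
      {within chart_dom c, continuous (chart_map c)} &
      {within chart_img c, continuous (chart_inv c)}].

Definition compatible_charts (c c' : chart) : Prop :=
  smooth_on (chart_map c @` (chart_dom c `&` chart_dom c'))
            (chart_map c' \o chart_inv c).

Definition is_smooth_atlas (S : set E) (A : set chart) : Prop :=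
  [/\ forall c, A c -> is_chart S c,
      forall x, S x -> exists2 c, A c & chart_dom c x &
      forall c c', A c -> A c' -> compatible_charts c c'].

(* chart_inv c is the coordinate expression, in the chart c of S, of the
   inclusion of S into E. *)
Definition inclusion_immersion (A : set chart) : Prop :=
  forall c, A c -> smooth_on (chart_img c) (chart_inv c) /\
    forall y, chart_img c y -> injective ('d (chart_inv c) y).

(* S, with the topology induced by E, carries a smooth structure of dimension d
   for which the inclusion into E is an immersion. The inclusion is then an
   embedding, and S is Hausdorff and (for E of finite dimension) second
   countable, because the topology of S is the subspace one. *)
Definition embedded_submanifold (S : set E) : Prop :=
  exists A : set chart, is_smooth_atlas S A /\ inclusion_immersion A.

End EmbeddedSubmanifold.

(* J_{2m}; the size 2m is written m + m, as block_mx requires. *)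
Definition Jmx (R : realType) (m : nat) : 'M[R]_(m + m) :=
  block_mx 0 1%:M (- 1%:M) 0.

(* Sp(2p, 2n). The norm carried by matrices in the library is the maximum norm,
   which induces the same topology and the same differentiable maps as the
   Euclidean one. *)
Definition symplectic_stiefel (R : realType) (p n : nat) :
    set 'M[R]_(n + n, p + p) :=
  [set X | X^T *m Jmx R n *m X = Jmx R p].

Arguments symplectic_stiefel : clear implicits.

(* Main.v *)
Require Import Defs.
From HB Require Import structures.
From mathcomp Require Import all_boot all_order all_algebra zify.
From mathcomp Require Import all_classical all_reals all_analysis.
Import numFieldNormedType.Exports.

(** The set is [X^T J X = G] with [J] antisymmetric and [G] invertible, and it
    is covered by explicit rational charts.

    The charts are a matrix analogue of the stereographic projection. Fix a
    point [X0] of the set and put [B = X0^T J]. Like a sphere seen from the pole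
    opposite to [X0], the set is seen from [- X0]: write [X + X0 = T M], where
    [M = B (X + X0)] is the slope and [T], normalized by [B T = 1], is the
    direction. Since [- X0] satisfies the equation too, the terms of degree 0
    cancel in the equation of [X], which becomes [M^T (T^T J T) M = M - M^T],
    that is
                        [T^T J T = M^-T - M^-1],
    and this says exactly that [N = M^-1 + T^T J T / 2] is a symmetric matrix.
    Hence [X |-> (T, N)] identifies the points of the set whose slope is
    invertible with the pairs such that [B T = 1], [N] is symmetric and
    [N - T^T J T / 2] is invertible; these pairs form an open subset of an
    affine space, of dimension [(2n - 2p) 2p] for [T] (translates of the kernel
    of [B]) plus [2p (2p + 1) / 2] for [N]. At [X0] the slope is [2 G], so [X0]
    lies in its own chart ([stereo_chart_center]). Both the chart and its
    inverse are rational in matrix entries, the chart being defined on an open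
    subset of the ambient space.

    The passage to manifolds is [embedded_submanifold_ambient]: charts that
    extend smoothly to open sets of the ambient space are automatically
    compatible, by composition, and their inverses are automatically immersions,
    by differentiating [chart_map \o chart_inv = id]. Closedness holds because
    [X |-> X^T J X] is continuous. *)

Set Implicit Arguments.
Unset Strict Implicit.
Unset Printing Implicit Defensive.

Import Order.TTheory GRing.Theory Num.Theory.
Local Open Scope classical_set_scope.
Local Open Scope ring_scope.

(** * Differentiation is local *)

Section Locality.
Variables (R : realType) (V W : normedModType R).

Lemma near_eq_derive (f g : V -> W) (x v : V) :
  (\forall y \near x, f y = g y) -> 'D_v f x = 'D_v g x.
Proof.
move=> fg.
have fgx : f x = g x by exact: nbhs_singleton fg.
have fg0 : \forall h \near (0 : R)^',
    h^-1 *: ((f \o shift x) (h *: v) - f x) =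
    h^-1 *: ((g \o shift x) (h *: v) - g x).
  have c : (fun h : R => h *: v + x) @ (0 : R) --> x.
    rewrite -[X in _ --> X]add0r -[X in _ --> X + _](scale0r v).
    by apply: cvgD; [apply: cvgZr_tmp; exact: cvg_id|exact: cvg_cst].
  have := c _ fg; move=> /nbhs_dnbhs; apply: filterS => h /= ->.
  by rewrite fgx.
rewrite /derive; congr (lim _); apply/seteqP; split=> A.
- by apply: filterS2 fg0 => h /= e; rewrite e.
- by apply: filterS2 fg0 => h /= e; rewrite e.
Qed.

Lemma near_eq_differentiable (f g : V -> W) (x : V) :
  (\forall y \near x, f y = g y) -> differentiable f x -> differentiable g x.
Proof.
move=> fg df; have fgx : f x = g x by exact: nbhs_singleton fg.
have cdf : continuous ('d f x : V -> W) by exact: diff_continuous.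
(* The expansion of f at x, term by term, is an expansion of g. *)
have dg : g \o shift x = cst (g x) + 'd f x +o_ 0 id.
  apply/eqaddoP => e e0.
  have := diff_locally df => /eqaddoP /(_ _ e0) H.
  have c : (fun h : V => h + x) @ (0 : V) --> x.
    rewrite -[X in _ --> X]add0r.
    by apply: cvgD; [exact: cvg_id|exact: cvg_cst].
  near=> h.
  have efg : f (h + x) = g (h + x) by near: h; exact: c _ fg.
  rewrite (_ : (g \o shift x - (cst (g x) + 'd f x)) h =
    (f \o shift x - (cst (f x) + 'd f x)) h); first by near: h.
  by rewrite !fctE /= -fgx -efg.
have e := diff_unique cdf dg.
by apply/diff_locallyP; rewrite e.
Unshelve. all: by end_near. Qed.

End Locality.

(** * Calculus of functions of class C^k *)

Section CkTheory.
Variables (R : realType) (V : normedModType R).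
Implicit Types (D : set V) (k : nat).

(** Openness of [D] matters: the recursive clause of [Ck_on] differentiates, and
    a derivative at a point of [D] only sees [f] near that point. The rules of
    differentiation below hold at the points of [D] only, and this lemma is what
    allows one to substitute them in the recursion. *)
Lemma eq_Ck_on (W : normedModType R) k D (f g : V -> W) :
  open D -> (forall x, D x -> f x = g x) -> Ck_on k D f -> Ck_on k D g.
Proof.
move=> oD; elim: k f g => [|k IH] f g fg.
  move=> cf x Dx; have nfg : \forall y \near x, f y = g y.
    by apply: filterS (open_nbhs_nbhs (conj oD Dx)).
  rewrite /prop_for /continuous_at -(fg _ Dx).
  by apply: cvg_trans (cf x Dx); apply: near_eq_cvg.
move=> [df Df]; split=> [x Dx|v].
  apply: near_eq_differentiable (df x Dx).
  by apply: filterS (open_nbhs_nbhs (conj oD Dx)).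
apply: IH (Df v) => x Dx; apply: near_eq_derive.
by apply: filterS (open_nbhs_nbhs (conj oD Dx)).
Qed.

Lemma Ck_on_continuous (W : normedModType R) k D (f : V -> W) :
  Ck_on k D f -> forall x, D x -> {for x, continuous f}.
Proof.
case: k => [|k] fk x Dx; first exact: fk.
by apply: differentiable_continuous; exact: fk.1.
Qed.

Lemma Ck_onW (W : normedModType R) k D (f : V -> W) :
  Ck_on k.+1 D f -> Ck_on k D f.
Proof.
elim: k f => [|k IH] f; first by move=> fk x Dx; exact: (Ck_on_continuous fk).
by move=> [df Df]; split => // v; apply: IH; exact: Df.
Qed.

Lemma sub_Ck_on (W : normedModType R) k D D' (f : V -> W) :
  D' `<=` D -> Ck_on k D f -> Ck_on k D' f.
Proof.
move=> D'D; elim: k f => [|k IH] f; first by move=> cf x /D'D; exact: cf.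
by move=> [df Df]; split=> [x /D'D Dx|v]; [exact: df|exact: IH (Df v)].
Qed.

Lemma Ck_on_cst (W : normedModType R) k D (a : W) : Ck_on k D (fun=> a).
Proof.
elim: k a => [|k IH] a; first by move=> x _; exact: cvg_cst.
split=> [x _|v]; first exact: differentiable_cst.
rewrite (_ : 'D_v _ = fun=> 0); first exact: IH.
by apply/funext => x; rewrite derive_cst.
Qed.

Lemma Ck_on_id k D : Ck_on k D (@id V).
Proof.
case: k => [|k]; first by move=> x _; exact: cvg_id.
split=> [x _|v]; first exact: ex_diff.
rewrite (_ : 'D_v _ = fun=> v); first exact: Ck_on_cst.
by apply/funext => x; rewrite derive_id.
Qed.

Lemma Ck_on_linear (W W' : normedModType R) (h : W -> W') k D (f : V -> W) :
  linear h -> continuous h -> open D -> Ck_on k D f ->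
  Ck_on k D (fun x => h (f x)).
Proof.
move=> lh cl oD; pose hM := GRing.isLinear.Build _ _ _ _ _ lh.
pose l : {linear W -> W'} := HB.pack h hM.
rewrite -[h]/(l : W -> W') in cl *.
elim: k f => [|k IH] f.
  by move=> cf x Dx; apply: continuous_comp; [exact: cf|exact: cl].
move=> [df Df]; have dl y : differentiable l y by exact: linear_differentiable.
have dlf x : D x -> differentiable (l \o f) x.
  by move=> Dx; apply: differentiable_comp; [exact: df|exact: dl].
split=> [x Dx|v]; first exact: dlf.
apply: (eq_Ck_on (f := fun x => l ('D_v f x))) => //; last exact: IH (Df v).
move=> x Dx; rewrite deriveE; last exact: df.
rewrite -[RHS]/('D_v (l \o f) x) deriveE; last exact: dlf.
rewrite (diff_comp (df x Dx) (dl (f x))).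
by rewrite /= (diff_lin (f x) cl).
Qed.

Lemma Ck_onD (W : normedModType R) k D (f g : V -> W) :
  open D -> Ck_on k D f -> Ck_on k D g -> Ck_on k D (fun x => f x + g x).
Proof.
move=> oD; elim: k f g => [|k IH] f g.
  by move=> cf cg x Dx; apply: continuousD; [exact: cf|exact: cg].
move=> [df Df] [dg Dg]; split=> [x Dx|v].
  by apply: differentiableD; [exact: df|exact: dg].
apply: (eq_Ck_on (f := fun x => 'D_v f x + 'D_v g x)) => //; last first.
  exact: IH (Df v) (Dg v).
move=> x Dx; rewrite -[RHS]/('D_v (f + g) x) deriveD//.
- exact/diff_derivable/df.
- exact/diff_derivable/dg.
Qed.

Lemma Ck_on_sum (W : normedModType R) (I : Type) (r : seq I) (P : pred I) k D
    (f : I -> V -> W) :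
  open D -> (forall i, P i -> Ck_on k D (f i)) ->
  Ck_on k D (fun x => \sum_(i <- r | P i) f i x).
Proof.
move=> oD fk; elim: r => [|i r IH].
  under [X in Ck_on _ _ X]eq_fun do rewrite big_nil.
  exact: Ck_on_cst.
under [X in Ck_on _ _ X]eq_fun do rewrite big_cons.
by case: (boolP (P i)) => // Pi; apply: Ck_onD => //; exact: fk.
Qed.

Lemma Ck_onM k D (f g : V -> R) :
  open D -> Ck_on k D f -> Ck_on k D g -> Ck_on k D (fun x => f x * g x).
Proof.
move=> oD; elim: k f g => [|k IH] f g.
  by move=> cf cg x Dx; apply: continuousM; [exact: cf|exact: cg].
move=> fk gk; have [[df Df] [dg Dg]] := (fk, gk).
split=> [x Dx|v]; first by apply: differentiableM; [exact: df|exact: dg].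
apply: (eq_Ck_on (f := fun x => f x * 'D_v g x + g x * 'D_v f x)) => //.
  move=> x Dx; rewrite -[RHS]/('D_v (f * g) x) deriveM//.
  - exact/diff_derivable/df.
  - exact/diff_derivable/dg.
apply: Ck_onD => //; first exact: IH (Ck_onW fk) (Dg v).
exact: IH (Ck_onW gk) (Df v).
Qed.

(** The induction closes because the derivative of [1 / f] is expressed with
    [1 / f] itself and the derivative of [f], both already of class C^k. *)
Lemma Ck_onV k D (f : V -> R) :
  open D -> (forall x, D x -> f x != 0) -> Ck_on k D f ->
  Ck_on k D (fun x => (f x)^-1).
Proof.
move=> oD f0; elim: k => [|k IH].
  by move=> cf x Dx; apply: continuousV; [exact: f0|exact: cf].
move=> fk; have [df Df] := fk; have fVk := IH (Ck_onW fk).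
split=> [x Dx|v]; first by apply: differentiableV; [exact: df|exact: f0].
pose g x := (- 1 * ((f x)^-1 * (f x)^-1)) * 'D_v f x.
apply: (eq_Ck_on (f := g)) => //.
  move=> x Dx; rewrite deriveV; last by exact/diff_derivable/df.
    by rewrite /g mulN1r -invfM -expr2.
  exact: f0.
apply: Ck_onM (Df v) => //; apply: Ck_onM => //; first exact: Ck_on_cst.
exact: Ck_onM.
Qed.

End CkTheory.

(** * Matrix-valued functions of class C^k *)

Section CkMatrix.
Variables (R : realType) (V : normedModType R) (D : set V) (k : nat).
Hypothesis oD : open D.

Lemma Ck_on_coord m n (f : V -> 'M[R]_(m, n)) i j :
  Ck_on k D f -> Ck_on k D (fun x => f x i j).
Proof.
move=> fk; apply: (Ck_on_linear (h := fun M : 'M[R]_(m, n) => M i j)) => //.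
  by move=> a M N; rewrite !mxE.
exact: coord_continuous.
Qed.

Lemma Ck_on_scalel (W : normedModType R) (f : V -> R) (w : W) :
  Ck_on k D f -> Ck_on k D (fun x => f x *: w).
Proof.
move=> fk; apply: (Ck_on_linear (h := fun a : R => a *: w)) => //.
  by move=> a b c; rewrite scalerDl scalerA.
exact: scalel_continuous.
Qed.

(** Expanding along the [delta_mx i j] reduces [h] to the coordinates, which are
    continuous: in finite dimension, linear maps are smooth. *)
Lemma Ck_on_mxlinear (W : normedModType R) m n (h : 'M[R]_(m, n) -> W)
    (f : V -> 'M[R]_(m, n)) :
  linear h -> Ck_on k D f -> Ck_on k D (fun x => h (f x)).
Proof.
move=> lh fk; pose hM := GRing.isLinear.Build _ _ _ _ _ lh.
pose l : {linear 'M[R]_(m, n) -> W} := HB.pack h hM.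
have -> : (fun x => h (f x)) =
    (fun x => \sum_i \sum_j f x i j *: h (delta_mx i j)).
  apply/funext => x; rewrite -[h]/(l : _ -> _) {1}[f x]matrix_sum_delta.
  rewrite linear_sum; apply: eq_bigr => i _.
  by rewrite linear_sum; apply: eq_bigr => j _; rewrite linearZ.
apply: Ck_on_sum => // i _; apply: Ck_on_sum => // j _.
exact/Ck_on_scalel/Ck_on_coord.
Qed.

Lemma Ck_on_mx m n (f : V -> 'M[R]_(m, n)) :
  (forall i j, Ck_on k D (fun x => f x i j)) -> Ck_on k D f.
Proof.
move=> fk.
have -> : f = (fun x => \sum_i \sum_j f x i j *: delta_mx i j).
  by apply/funext => x; exact: matrix_sum_delta.
apply: Ck_on_sum => // i _; apply: Ck_on_sum => // j _.
exact: Ck_on_scalel.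
Qed.

Lemma Ck_on_mulmx m n p (f : V -> 'M[R]_(m, n)) (g : V -> 'M[R]_(n, p)) :
  Ck_on k D f -> Ck_on k D g -> Ck_on k D (fun x => f x *m g x).
Proof.
move=> fk gk; apply: Ck_on_mx => i j.
under [X in Ck_on _ _ X]eq_fun do rewrite mxE.
by apply: Ck_on_sum => // l _; apply: Ck_onM => //; exact: Ck_on_coord.
Qed.

Lemma Ck_on_prod (I : Type) (r : seq I) (f : I -> V -> R) :
  (forall i, Ck_on k D (f i)) -> Ck_on k D (fun x => \prod_(i <- r) f i x).
Proof.
move=> fk; elim: r => [|i r IH].
  under [X in Ck_on _ _ X]eq_fun do rewrite big_nil.
  exact: Ck_on_cst.
under [X in Ck_on _ _ X]eq_fun do rewrite big_cons.
exact: Ck_onM.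
Qed.

Lemma Ck_on_det n (f : V -> 'M[R]_n) :
  Ck_on k D f -> Ck_on k D (fun x => \det (f x)).
Proof.
move=> fk; apply: Ck_on_sum => // s _; apply: Ck_onM => //.
  exact: Ck_on_cst.
by apply: Ck_on_prod => i; exact: Ck_on_coord.
Qed.

(** Cramer's rule: the inverse is rational in the entries. *)
Lemma Ck_on_invmx n (f : V -> 'M[R]_n) :
  (forall x, D x -> f x \in unitmx) -> Ck_on k D f ->
  Ck_on k D (fun x => invmx (f x)).
Proof.
move=> fU fk; pose g x := (\det (f x))^-1 *: \adj (f x).
apply: (eq_Ck_on (f := g)) => //.
  by move=> x Dx; rewrite /g /invmx fU.
apply: Ck_on_mx => i j.
under [X in Ck_on _ _ X]eq_fun do rewrite !mxE.
apply: Ck_onM => //.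
  apply: Ck_onV => //; last exact: Ck_on_det.
  by move=> x /fU; rewrite unitmxE unitfE.
apply: Ck_onM => //; first exact: Ck_on_cst.
apply: Ck_on_det; apply: Ck_on_mx => i' j'.
under [X in Ck_on _ _ X]eq_fun do rewrite !mxE.
exact: Ck_on_coord.
Qed.

End CkMatrix.

(** As [Ck_on] only speaks of derivatives in constant directions, the chain rule
    has to be expanded in coordinates: the direction [D_v f x], which depends on
    [x], is decomposed on the [delta_mx i j]. *)
Lemma Ck_on_comp (R : realType) (V : normedModType R) m n a b k (D : set V)
    (O : set 'M[R]_(m, n)) (f : V -> 'M[R]_(m, n))
    (g : 'M[R]_(m, n) -> 'M[R]_(a, b)) :
  open D -> (forall x, D x -> O (f x)) ->
  Ck_on k D f -> Ck_on k O g -> Ck_on k D (g \o f).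
Proof.
move=> oD fO; elim: k g => [|k IH] g.
  by move=> cf cg x Dx; apply: continuous_comp; [exact: cf|exact/cg/fO].
move=> fk gk; have [[df Df] [dg Dg]] := (fk, gk).
have dgf x : D x -> differentiable (g \o f) x.
  by move=> Dx; exact: differentiable_comp (df x Dx) (dg _ (fO x Dx)).
split=> // v.
pose h x := \sum_i \sum_j ('D_v f x i j) *: ('D_(delta_mx i j) g (f x)).
apply: (eq_Ck_on (f := h)) => //.
  move=> x Dx; rewrite deriveE; last exact: dgf.
  rewrite (diff_comp (df x Dx) (dg _ (fO x Dx))) /= -(deriveE v (df x Dx)).
  rewrite [X in 'd g _ X]matrix_sum_delta linear_sum; apply: eq_bigr => i _.
  rewrite linear_sum; apply: eq_bigr => j _.
  by rewrite linearZ /= (deriveE _ (dg _ (fO x Dx))).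
apply: Ck_on_sum => // i _; apply: Ck_on_sum => // j _.
apply: Ck_on_mx => // i' j'.
under [X in Ck_on _ _ X]eq_fun do rewrite mxE.
apply: Ck_onM => //; first exact: (Ck_on_coord oD _ _ (Df v)).
by apply: Ck_on_coord => //; exact: (IH _ (Ck_onW fk) (Dg _)).
Qed.

(** * Embedded submanifolds from charts that extend to the ambient space *)

Section Atlas.
Variables (R : realType) (m n d : nat).
Local Notation E := 'M[R]_(m, n).

(** Requiring [chart_map] to be smooth on an open set of the ambient space,
    rather than along [S] only, is what makes compatibility and the immersion
    property consequences of the chain rule. *)
Definition ambient_smooth_chart (S : set E) (c : chart E d) : Prop :=
  (exists O : set E,
    [/\ open O, chart_dom c = S `&` O & smooth_on O (chart_map c)]) /\
  [/\ open (chart_img c), smooth_on (chart_img c) (chart_inv c) &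
      forall x, chart_dom c x -> chart_inv c (chart_map c x) = x].

Lemma ambient_chart_imgK (S : set E) (c : chart E d) u :
  ambient_smooth_chart S c -> chart_img c u ->
  chart_dom c (chart_inv c u) /\ chart_map c (chart_inv c u) = u.
Proof. by move=> [_ [_ _ cK]] [x dx <-]; rewrite cK. Qed.

Lemma ambient_chart_is_chart (S : set E) (c : chart E d) :
  ambient_smooth_chart S c -> is_chart S c.
Proof.
move=> [[Q [oQ dQ sQ]] [oI sI cK]]; split=> //; first by exists Q.
- apply: continuous_in_subspaceT => x; rewrite inE dQ => -[_ Qx].
  exact: (sQ 0%N).
- by apply: continuous_in_subspaceT => x; rewrite inE; exact: (sI 0%N).
Qed.

(** The transition map is the composite of [chart_inv c], smooth on an open
    subset of R^d, with the smooth extension of [chart_map c'] to [Q']. *)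
Lemma ambient_chart_compatible (S : set E) (c c' : chart E d) :
  ambient_smooth_chart S c -> ambient_smooth_chart S c' ->
  compatible_charts c c'.
Proof.
move=> Hc; have [[Q [oQ dQ sQ]] [oI sI cK]] := Hc.
move=> [[Q' [oQ' dQ' sQ']] _]; rewrite /compatible_charts.
have -> : chart_map c @` (chart_dom c `&` chart_dom c') =
    chart_img c `&` chart_inv c @^-1` Q'.
  apply/seteqP; split=> u.
    move=> [x [dx dx'] <-]; split; first by exists x.
    by rewrite /preimage/= cK//; move: dx'; rewrite dQ' => -[].
  move=> [Iu Q'u]; have [dx xu] := ambient_chart_imgK Hc Iu.
  exists (chart_inv c u) => //; split => //; rewrite dQ'; split=> //.
  by move: dx; rewrite dQ => -[].
have oD : open (chart_img c `&` chart_inv c @^-1` Q').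
  rewrite openE => u [Iu Q'u]; apply: filterI.
    exact: open_nbhs_nbhs (conj oI Iu).
  exact: (sI 0%N) Iu _ (open_nbhs_nbhs (conj oQ' Q'u)).
move=> k; apply: (Ck_on_comp oD _ _ (sQ' k)) => [u []//|].
by apply: sub_Ck_on (sI k) => u [].
Qed.

(** [chart_map c \o chart_inv c] is the identity near [u], so the differential
    of [chart_inv c] at [u] has a left inverse. *)
Lemma ambient_chart_immersion (S : set E) (c : chart E d) u :
  ambient_smooth_chart S c -> chart_img c u ->
  injective ('d (chart_inv c) u).
Proof.
move=> Hc Iu; have [[Q [oQ dQ sQ]] [oI sI cK]] := Hc.
have [dx xu] := ambient_chart_imgK Hc Iu.
have dI : differentiable (chart_inv c) u by exact: (sI 1%N).1.
have dM : differentiable (chart_map c) (chart_inv c u).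
  by apply: (sQ 1%N).1; move: dx; rewrite dQ => -[].
have H : 'd (chart_map c \o chart_inv c) u = id :> ('rV[R]_d -> 'rV[R]_d).
  apply/funext => v; rewrite -(deriveE v (differentiable_comp dI dM)).
  rewrite (@near_eq_derive _ _ _ _ id) ?derive_id//.
  near=> w; apply: (ambient_chart_imgK Hc _).2.
  by near: w; exact: open_nbhs_nbhs (conj oI Iu).
move=> v w vw; rewrite -[v]/(id v) -[w]/(id w) -H (diff_comp dI dM) /=.
by rewrite vw.
Unshelve. all: by end_near. Qed.

Lemma embedded_submanifold_ambient (S : set E) :
  (forall x, S x -> exists2 c : chart E d,
     ambient_smooth_chart S c & chart_dom c x) ->
  embedded_submanifold d S.
Proof.
move=> Sc; exists (ambient_smooth_chart S); split; first split => //.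
- by move=> c; exact: ambient_chart_is_chart.
- by move=> c c'; exact: ambient_chart_compatible.
move=> c Hc; split; first by case: (Hc) => _ [].
by move=> u; exact: ambient_chart_immersion Hc.
Qed.

End Atlas.

(** * Coordinates on the parameter space *)

(** [K] parametrizes the solutions of [B *m X = 0] column by column, and [L]
    reads their coordinates; there are [a - b] of them by the rank theorem. *)
Lemma kernel_column_basis (F : fieldType) (b a : nat) (B : 'M[F]_(b, a)) :
  row_free B ->
  exists (K : 'M[F]_(a, a - b)) (L : 'M[F]_(a - b, a)),
    [/\ B *m K = 0, L *m K = 1%:M &
        forall q (X : 'M[F]_(a, q)), B *m X = 0 -> K *m (L *m X) = X].
Proof.
move=> /eqP rB; have : \rank (kermx B^T) = (a - b)%N.
  by rewrite mxrank_ker mxrank_tr rB.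
(* The row basis is abstracted so that its height can be renamed [a - b]. *)
move: (row_base_free (kermx B^T)) (eq_row_base (kermx B^T)).
move: (row_base _) => P Pfree Pker; move: P Pfree Pker.
move: (\rank _) => c P Pfree Pker cE; subst c.
have [Q PQ] := row_freeP Pfree.
exists P^T, Q^T; split.
- apply: trmx_inj; rewrite trmx_mul trmxK trmx0; apply/eqP.
  by rewrite -sub_kermx -Pker.
- by rewrite -trmx_mul PQ trmx1.
- move=> q X BX; have : (X^T <= P)%MS.
    by rewrite Pker; apply/sub_kermxP; rewrite -trmx_mul BX trmx0.
  move=> /submxP[Y XY]; apply: trmx_inj.
  by rewrite !trmx_mul !trmxK XY -(mulmxA Y) PQ mulmx1.
Qed.

Section SymmetricCoordinates.
Variables (R : nzRingType) (b : nat).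

(** The entries on and above the diagonal are free coordinates on symmetric
    matrices. *)
Definition upper_pair := {ij : 'I_b * 'I_b | (ij.1 <= ij.2)%N}.

Definition sort_pair (i j : 'I_b) := if (i <= j)%N then (i, j) else (j, i).

Lemma sort_pair_upper i j : ((sort_pair i j).1 <= (sort_pair i j).2)%N.
Proof. by rewrite /sort_pair; case: (leqP i j) => //= /ltnW. Qed.

Definition upper_pair_of i j : upper_pair :=
  exist _ (sort_pair i j) (sort_pair_upper i j).

Lemma upper_pair_ofC i j : upper_pair_of i j = upper_pair_of j i.
Proof.
apply/val_inj; rewrite /= /sort_pair.
by case: (ltngtP i j) => // /val_inj ->.
Qed.

Lemma upper_pair_valK (k : upper_pair) :
  upper_pair_of (val k).1 (val k).2 = k.
Proof. by apply/val_inj; case: k => -[i j] /= ij; rewrite /sort_pair ij. Qed.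

Definition sym_of_row (v : 'rV[R]_#|{: upper_pair}|) : 'M[R]_b :=
  \matrix_(i, j) v 0 (enum_rank (upper_pair_of i j)).

Definition row_of_sym (N : 'M[R]_b) : 'rV[R]_#|{: upper_pair}| :=
  \row_k N (val (enum_val k)).1 (val (enum_val k)).2.

Lemma trmx_sym_of_row v : (sym_of_row v)^T = sym_of_row v.
Proof. by apply/matrixP => i j; rewrite !mxE upper_pair_ofC. Qed.

Lemma sym_of_rowK : cancel sym_of_row row_of_sym.
Proof.
by move=> v; apply/rowP => k; rewrite !mxE upper_pair_valK enum_valK.
Qed.

Lemma row_of_symK N : N^T = N -> sym_of_row (row_of_sym N) = N.
Proof.
move=> NT; apply/matrixP => i j; rewrite !mxE enum_rankK /= /sort_pair.
by case: (leqP i j) => //= _; rewrite -{1}NT mxE.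
Qed.

(** Column [j] contributes the [j.+1] indices [i <= j]. *)
Lemma card_upper_pair : #|{: upper_pair}| = 'C(b.+1, 2).
Proof.
pose le_ord (i j : 'I_b) := (i <= j)%N.
rewrite card_sig -sum1_card.
rewrite -(pair_big_dep xpredT le_ord (fun _ _ => 1%N)) /=.
rewrite (exchange_big_dep xpredT) //= -bin2_sum big_mkord.
rewrite big_ord_recl add0n; apply: eq_bigr => j _.
rewrite sum1_card -[RHS]card_ord.
pose h (i : 'I_j.+1) : 'I_b := widen_ord (ltn_ord j) i.
rewrite -(card_imset _ (f := h)); last by move=> x y /(congr1 val) /= /val_inj.
apply: eq_card => i; apply/idP/imsetP => [ij|[k _ ->]].
  by exists (Ordinal (ij : (i < j.+1)%N)) => //; apply/val_inj.
by rewrite unfold_in /=; exact: (ltn_ord k).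
Qed.

End SymmetricCoordinates.

(** The left-hand side is the ambient dimension minus the number [p (2p - 1)] of
    independent equations; the right-hand side is the number of coordinates of
    the charts: [T] modulo the kernel condition, plus a symmetric matrix. *)
Lemma stiefel_dimension p n : (0 < p)%N -> (p <= n)%N ->
  (4 * n * p - p * (2 * p - 1))%N =
  ((n + n - (p + p)) * (p + p) + 'C((p + p).+1, 2))%N.
Proof.
move=> p0 pn; rewrite bin2 /=.
have -> : ((p + p).+1 * (p + p))./2 = (p * (p + p).+1)%N.
  by rewrite addnn -muln2 mulnA muln2 doubleK mulnC.
move: p0 pn; case: p => // p _; move=> /subnK <-; move: (n - p.+1)%N => q.
nia.
Qed.

(** * Stereographic charts *)

Lemma open_unitmx_preim (R : realType) (V : normedModType R) b
    (f : V -> 'M[R]_b) :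
  Ck_on 0 setT f -> open [set x | f x \in unitmx].
Proof.
move=> f0; have -> : [set x | f x \in unitmx] =
    (fun x => \det (f x)) @^-1` [set r : R | r != 0].
  by apply/seteqP; split=> x /=; rewrite unitmxE unitfE.
apply: open_comp; last exact: open_neq.
by move=> x _; exact: (Ck_on_det openT f0).
Qed.

Section Stereographic.
Variables (R : realType) (a b : nat) (J : 'M[R]_a) (X0 : 'M[R]_(a, b)).
Hypothesis JT : J^T = - J.

Let B := X0^T *m J.
Let G := B *m X0.

Definition slope (X : 'M[R]_(a, b)) : 'M[R]_b := B *m (X + X0).

Definition direction (X : 'M[R]_(a, b)) := (X + X0) *m invmx (slope X).

(** The matrix [N] attached to a direction [T] and to the inverse [W] of a
    slope. When [B *m T = 1], it is symmetric exactly when [T *m invmx W - X0]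
    lies on the set ([sym_param_sym], [quad_of_direction]). *)
Definition sym_param (T : 'M[R]_(a, b)) (W : 'M[R]_b) : 'M[R]_b :=
  W + 2^-1 *: (T^T *m J *m T).

Lemma quad_skew q (T : 'M[R]_(a, q)) : (T^T *m J *m T)^T = - (T^T *m J *m T).
Proof. by rewrite !trmx_mul trmxK JT mulNmx mulmxN mulmxA. Qed.

Lemma trmx_base_pairing q (X : 'M[R]_(a, q)) : X^T *m J *m X0 = - (B *m X)^T.
Proof. by rewrite /B !trmx_mul trmxK JT mulNmx mulmxN opprK mulmxA. Qed.

(** Seen from [- X0], the equation of the set has no constant term. *)
Lemma quad_antipode (Y : 'M[R]_(a, b)) :
  (Y - X0)^T *m J *m (Y - X0) = G <->
  Y^T *m J *m Y = B *m Y - (B *m Y)^T.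
Proof.
have -> : (Y - X0)^T *m J *m (Y - X0) =
    Y^T *m J *m Y - (B *m Y - (B *m Y)^T) + G.
  rewrite [(Y - X0)^T]linearB /= !mulmxBl !mulmxBr -/B -/G trmx_base_pairing.
  by rewrite opprK !opprB -!addrA [G - _]addrC.
split => [/eqP|->]; last by rewrite subrr add0r.
by rewrite -[X in _ == X]add0r (inj_eq (addIr _)) subr_eq0 => /eqP.
Qed.

(** With [Q = T^T J T] and [V] the inverse of the slope, this turns the equation
    of the set, in the form [Q = V^T - V], into a linear condition on
    [N = V + Q / 2]. *)
Lemma skew_half_sym (V Q : 'M[R]_b) : Q^T = - Q ->
  (V + 2^-1 *: Q)^T = V + 2^-1 *: Q <-> Q = V^T - V.
Proof.
move=> QT; have half : 2^-1 *: Q + 2^-1 *: Q = Q.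
  by rewrite -scalerDl -[2^-1]div1r -splitr scale1r.
rewrite linearD linearZ /= QT scalerN; split => [/eqP|Qe].
  by rewrite subr_eq -addrA half [V + _]addrC -subr_eq eq_sym => /eqP.
by apply/eqP; rewrite subr_eq -addrA half [X in V + X]Qe addrC subrK.
Qed.

Lemma direction_base X : slope X \in unitmx -> B *m direction X = 1%:M.
Proof. by move=> U; rewrite /direction mulmxA mulmxV. Qed.

Lemma direction_slope X : slope X \in unitmx -> direction X *m slope X = X + X0.
Proof. by move=> U; rewrite /direction mulmxKV. Qed.

Lemma sym_param_sym X : X^T *m J *m X = G -> slope X \in unitmx ->
  (sym_param (direction X) (invmx (slope X)))^T =
   sym_param (direction X) (invmx (slope X)).
Proof.
move=> SX U; apply/skew_half_sym; first exact: quad_skew.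
have /quad_antipode E : ((X + X0) - X0)^T *m J *m ((X + X0) - X0) = G.
  by rewrite addrK.
rewrite /direction trmx_mul -!mulmxA (mulmxA J) (mulmxA (X + X0)^T).
rewrite (mulmxA (X + X0)^T) E -/(slope X) mulmxBl mulmxBr mulmxV// mulmx1.
by rewrite mulmxA -trmx_mul mulmxV// trmx1 mul1mx.
Qed.

Lemma quad_of_direction T W : B *m T = 1%:M -> W \in unitmx ->
  (sym_param T W)^T = sym_param T W ->
  (T *m invmx W - X0)^T *m J *m (T *m invmx W - X0) = G.
Proof.
move=> BT WU /skew_half_sym; rewrite quad_skew => /(_ erefl) TJT.
apply/quad_antipode; rewrite (mulmxA B) BT mul1mx.
rewrite trmx_mul -!mulmxA (mulmxA J) (mulmxA T^T) (mulmxA T^T) TJT.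
rewrite mulmxBl mulmxBr mulmxV// mulmx1 mulmxA -trmx_mul.
by rewrite mulmxV// trmx1 mul1mx.
Qed.


(** The coordinates of a chart are those of [T], relative to the base point
    [X0 *m invmx G] of the affine space [B *m T = 1] and to the kernel basis
    [K], followed by the upper triangular entries of [N]. *)
Section Chart.
Variables (K : 'M[R]_(a, a - b)) (L : 'M[R]_(a - b, a)).
Hypothesis (BK : B *m K = 0) (LK : L *m K = 1%:M).
Hypothesis (KL : forall X : 'M[R]_(a, b), B *m X = 0 -> K *m (L *m X) = X).
Hypothesis (GU : G \in unitmx).

Notation dim := ((a - b) * b + #|{: upper_pair b}|)%N.

Definition row_direction (u : 'rV[R]_dim) : 'M[R]_(a, b) :=
  X0 *m invmx G + K *m vec_mx (lsubmx u).

Definition row_inv_slope (u : 'rV[R]_dim) : 'M[R]_b :=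
  sym_of_row (rsubmx u) -
  2^-1 *: ((row_direction u)^T *m J *m row_direction u).

Definition stereo_inv (u : 'rV[R]_dim) : 'M[R]_(a, b) :=
  row_direction u *m invmx (row_inv_slope u) - X0.

Definition stereo (X : 'M[R]_(a, b)) : 'rV[R]_dim :=
  row_mx (mxvec (L *m (direction X - X0 *m invmx G)))
         (row_of_sym (sym_param (direction X) (invmx (slope X)))).

Definition stereo_chart : chart 'M[R]_(a, b) dim :=
  Chart ([set X | X^T *m J *m X = G] `&` [set X | slope X \in unitmx])
        stereo stereo_inv.

Lemma base_center : B *m (X0 *m invmx G) = 1%:M.
Proof. by rewrite mulmxA -/G mulmxV. Qed.

Lemma base_row_direction u : B *m row_direction u = 1%:M.
Proof. by rewrite mulmxDr base_center mulmxA BK mul0mx addr0. Qed.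

Lemma row_direction_stereo X : slope X \in unitmx ->
  row_direction (stereo X) = direction X.
Proof.
move=> U; rewrite /row_direction row_mxKl mxvecK KL ?subrKC//.
by rewrite mulmxBr direction_base// base_center subrr.
Qed.

Lemma row_inv_slope_stereo X : X^T *m J *m X = G -> slope X \in unitmx ->
  row_inv_slope (stereo X) = invmx (slope X).
Proof.
move=> SX U; rewrite /row_inv_slope row_direction_stereo// row_mxKr.
by rewrite row_of_symK ?addrK//; exact: sym_param_sym.
Qed.

Lemma stereoK X : X^T *m J *m X = G -> slope X \in unitmx ->
  stereo_inv (stereo X) = X.
Proof.
move=> SX U; rewrite /stereo_inv row_inv_slope_stereo// row_direction_stereo//.
by rewrite invmxK direction_slope// addrK.
Qed.

Lemma slope_stereo_inv u : slope (stereo_inv u) = invmx (row_inv_slope u).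
Proof. by rewrite /slope subrK mulmxA base_row_direction mul1mx. Qed.

Lemma sym_param_row u :
  sym_param (row_direction u) (row_inv_slope u) = sym_of_row (rsubmx u).
Proof. by rewrite /sym_param subrK. Qed.

Lemma stereo_inv_quad u : row_inv_slope u \in unitmx ->
  (stereo_inv u)^T *m J *m stereo_inv u = G.
Proof.
move=> U; apply: quad_of_direction => //; first exact: base_row_direction.
by rewrite sym_param_row trmx_sym_of_row.
Qed.

Lemma stereo_invK u : row_inv_slope u \in unitmx -> stereo (stereo_inv u) = u.
Proof.
move=> U; rewrite /stereo.
have -> : direction (stereo_inv u) = row_direction u.
  by rewrite /direction slope_stereo_inv invmxK subrK mulmxKV.
rewrite slope_stereo_inv invmxK sym_param_row sym_of_rowK.
by rewrite addrAC subrr add0r mulmxA LK mul1mx vec_mxK hsubmxK.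
Qed.

(** Every [u] for which [stereo_inv u] makes sense is in the image; the image is
    therefore open although it is defined through points of the set only. *)
Lemma stereo_chart_img :
  chart_img stereo_chart = [set u | row_inv_slope u \in unitmx].
Proof.
apply/seteqP; split=> u /=.
  by move=> [X [SX U] <-]; rewrite /mkset row_inv_slope_stereo// unitmx_inv.
move=> U; exists (stereo_inv u); last exact: stereo_invK.
split; first exact: stereo_inv_quad.
by rewrite /mkset slope_stereo_inv unitmx_inv.
Qed.

Lemma Ck_on_slope k : Ck_on k setT slope.
Proof.
apply: Ck_on_mulmx; [exact: openT|exact: Ck_on_cst|].
by apply: Ck_onD; [exact: openT|exact: Ck_on_id|exact: Ck_on_cst].
Qed.

Lemma Ck_on_row_direction k : Ck_on k setT row_direction.
Proof.
apply: Ck_onD; [exact: openT|exact: Ck_on_cst|].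
apply: Ck_on_mulmx; [exact: openT|exact: Ck_on_cst|].
apply: (Ck_on_mxlinear openT (h := vec_mx)); [exact: linearP|].
by apply: (Ck_on_mxlinear openT (h := lsubmx));
  [exact: linearP|exact: Ck_on_id].
Qed.

Lemma Ck_on_quad (V : normedModType R) k (D : set V) (f : V -> 'M[R]_(a, b)) :
  open D -> Ck_on k D f -> Ck_on k D (fun x => (f x)^T *m J *m f x).
Proof.
move=> oD fk; do 2![apply: Ck_on_mulmx => //]; last exact: Ck_on_cst.
by apply: (Ck_on_mxlinear oD (h := trmx)) => //; exact: linearP.
Qed.

Lemma Ck_on_row_inv_slope k : Ck_on k setT row_inv_slope.
Proof.
apply: Ck_onD; first exact: openT.
  apply: Ck_on_mx => [|i j]; first exact: openT.
  under [X in Ck_on _ _ X]eq_fun do rewrite mxE.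
  apply: Ck_on_coord; first exact: openT.
  by apply: (Ck_on_mxlinear openT (h := rsubmx));
    [exact: linearP|exact: Ck_on_id].
have Qk : Ck_on k setT
    (fun u => (row_direction u)^T *m J *m row_direction u).
  by apply: Ck_on_quad; [exact: openT|exact: Ck_on_row_direction].
under [X in Ck_on _ _ X]eq_fun do rewrite -scaleNr.
by apply: (Ck_on_mxlinear openT (h := *:%R _)) => //; exact: linearP.
Qed.

Lemma smooth_stereo_inv :
  smooth_on [set u | row_inv_slope u \in unitmx] stereo_inv.
Proof.
move=> k; have oU := open_unitmx_preim (Ck_on_row_inv_slope 0).
apply: Ck_onD => //; last exact: Ck_on_cst.
apply: Ck_on_mulmx => //.
  exact: (sub_Ck_on (@subsetT _ _) (Ck_on_row_direction k)).
apply: Ck_on_invmx => //.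
exact: (sub_Ck_on (@subsetT _ _) (Ck_on_row_inv_slope k)).
Qed.

Lemma smooth_stereo : smooth_on [set X | slope X \in unitmx] stereo.
Proof.
move=> k; have oU := open_unitmx_preim (Ck_on_slope 0).
have Mk : Ck_on k [set X | slope X \in unitmx] (fun X => invmx (slope X)).
  apply: Ck_on_invmx => //.
  exact: (sub_Ck_on (@subsetT _ _) (Ck_on_slope k)).
have Tk : Ck_on k [set X | slope X \in unitmx] direction.
  apply: Ck_on_mulmx => //; apply: Ck_onD => //; first exact: Ck_on_id.
  exact: Ck_on_cst.
apply: Ck_on_mx => // i j.
under [X in Ck_on _ _ X]eq_fun do rewrite mxE.
case: (fintype.split j) => {}j.
  apply: Ck_on_coord => //.
  apply: (Ck_on_mxlinear oU (h := mxvec)); first exact: linearP.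
  apply: Ck_on_mulmx => //; first exact: Ck_on_cst.
  by apply: Ck_onD => //; exact: Ck_on_cst.
under [X in Ck_on _ _ X]eq_fun do rewrite mxE.
apply: Ck_on_coord => //; apply: Ck_onD => //.
by apply: (Ck_on_mxlinear oU (h := *:%R _));
  [exact: linearP|exact: Ck_on_quad].
Qed.

Lemma stereo_chart_ambient_smooth :
  ambient_smooth_chart [set X | X^T *m J *m X = G] stereo_chart.
Proof.
split.
  exists [set X | slope X \in unitmx]; split => //; last exact: smooth_stereo.
  exact: open_unitmx_preim (Ck_on_slope 0).
rewrite stereo_chart_img; split.
- exact: open_unitmx_preim (Ck_on_row_inv_slope 0).
- exact: smooth_stereo_inv.
- by move=> X [SX U]; exact: stereoK.
Qed.

(** The slope of [X0] is [2 G]. *)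
Lemma stereo_chart_center : chart_dom stereo_chart X0.
Proof.
split; rewrite /mkset //= /slope mulmxDr -/G -mulr2n -scaler_nat.
by rewrite unitmxZ // unitfE pnatr_eq0.
Qed.

End Chart.
End Stereographic.

(** * Embedded submanifolds defined by an alternating form *)

(** Invertibility of [G] makes the rows of [X0^T *m J] independent at every
    point [X0] of the set, so that the dimension is the same everywhere; and it
    makes the slope of [X0] in its own chart invertible. *)
Theorem embedded_submanifold_quad (R : realType) (a b : nat)
    (J : 'M[R]_a) (G : 'M[R]_b) : J^T = - J -> G \in unitmx ->
  embedded_submanifold ((a - b) * b + 'C(b.+1, 2))%N
    [set X : 'M[R]_(a, b) | X^T *m J *m X = G].
Proof.
move=> JT GU; rewrite -card_upper_pair.
apply: embedded_submanifold_ambient => X0 SX0.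
have X0G : X0^T *m J *m X0 = G by [].
have rfB : row_free (X0^T *m J).
  by apply/row_freeP; exists (X0 *m invmx G); rewrite mulmxA X0G mulmxV.
have [K [L [BK LK KL]]] := kernel_column_basis rfB.
exists (stereo_chart J X0 K L).
  rewrite -X0G; apply: stereo_chart_ambient_smooth => //; first exact: KL.
  by rewrite X0G.
by apply: stereo_chart_center; rewrite X0G.
Qed.

(** * The symplectic Stiefel manifold *)

Lemma trmx_Jmx (R : realType) m : (Jmx R m)^T = - Jmx R m.
Proof.
by rewrite /Jmx tr_block_mx opp_block_mx !linearN /= !trmx0 !trmx1 !oppr0 opprK.
Qed.

Lemma unitmx_Jmx (R : realType) m : Jmx R m \in unitmx.
Proof.
have /mulmx1_unit[] // : Jmx R m *m - Jmx R m = 1%:M.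
rewrite /Jmx opp_block_mx mulmx_block !oppr0 opprK !mulmx0 !mul0mx !mulmxN.
by rewrite !addr0 !add0r mulNmx mul1mx opprK -scalar_mx_block.
Qed.

Theorem proposition3p1 (R : realType) (p n : nat) (hp : (0 < p)%N)
    (hpn : (p <= n)%N) :
  closed (symplectic_stiefel R p n) /\
  embedded_submanifold (4 * n * p - p * (2 * p - 1))%N
    (symplectic_stiefel R p n).
Proof.
split; last first.
  rewrite stiefel_dimension//; apply: embedded_submanifold_quad.
    exact: trmx_Jmx.
  exact: unitmx_Jmx.
have -> : symplectic_stiefel R p n =
    (fun X : 'M[R]_(n + n, p + p) => X^T *m Jmx R n *m X) @^-1` [set Jmx R p].
  by [].
apply: preimage_closed; last first.
  exact/accessible_closed_set1/hausdorff_accessible/norm_hausdorff.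
have Qc : Ck_on 0 setT (fun X : 'M[R]_(n + n, p + p) => X^T *m Jmx R n *m X).
  by apply: Ck_on_quad; [exact: openT|exact: Ck_on_id].
by move=> X _; exact: (Qc X I).
Qed.
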